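(* Fix $\kappa\ge0$. Let $A\in C^0(\mathbb{R},\mathrm{SL}(2,\mathbb{R}))\cap C^2(\mathbb{R},\mathbb{M}^2)$ be a solution of $\ddot A(t)+\kappa A(t)=\lambda(t)\,\mathrm{cof}\,A(t)$ with initial data $(A(0),\dot A(0))=(A_0,B_0)\in\mathcal{D}$, and set $X_i=X_i(A_0,B_0)$, $i=1,2,3$. (i) $A$ is an equilibrium if and only if $X_1=\kappa$. (ii) $A$ is a rigid rotation if and only if $A_0\in\mathrm{SO}(2,\mathbb{R})$ and $X_1=\kappa+\tfrac14X_3^2$. In this case, $A(t)=U(\tfrac12X_3t)A_0$. (iii) $A$ is rigid with $|A_0|^2>2$ if and only if $|A_0|^2>2$ and both $$X_1=\frac12\left(\frac{X_2^2}{\frac12|A_0|^2-1}+\frac{X_3^2}{\frac12|A_0|^2+1}\right)+\frac\kappa2|A_0|^2$$ and $$\frac{X_2^2}{(\frac12|A_0|^2-1)^2}+\frac{X_3^2}{(\frac12|A_0|^2+1)^2}=2\kappa .$$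
   Context: $\mathbb{M}^2$ is the space of real $2\times2$ matrices with inner product $\langle A,B\rangle=\mathrm{tr}(A^\top B)$ and norm $|A|=\langle A,A\rangle^{1/2}$. $\mathrm{SL}(2,\mathbb{R})=\{A:\det A=1\}$; $\mathrm{SO}(2,\mathbb{R})$ is the rotation group, which equals $\{A\in\mathrm{SL}(2,\mathbb{R}):|A|^2=2\}$, and $|A|^2\ge2$ on $\mathrm{SL}(2,\mathbb{R})$. $Z=\begin{bmatrix}0&-1\\1&0\end{bmatrix}$, $U(\theta)=\cos\theta\,I+\sin\theta\,Z$, and $\mathrm{cof}\,A=ZAZ^\top$ is the cofactor matrix. $\mathcal{D}=\{(A,B)\in\mathbb{M}^2\times\mathbb{M}^2:\det A=1,\ \langle B,\mathrm{cof}\,A\rangle=0\}$ is the tangent bundle of $\mathrm{SL}(2,\mathbb{R})$. $$X_1(A,B)=\tfrac12|B|^2+\tfrac{\kappa}{2}|A|^2,\quad X_2(A,B)=\tfrac12\langle ZA-AZ,B\rangle,\quad X_3(A,B)=\tfrac12\langle ZA+AZ,B\rangle.$$ A solution of $\ddot A+\kappa A=\lambda\,\mathrm{cof}\,A$ means that the equation holds for some $\lambda\in C^0(\mathbb{R},\mathbb{R})$ (necessarily $\lambda(t)=2(\kappa-\det\dot A(t))/|A(t)|^2$). A solution is called an equilibrium if it is constant in $t$, rigid if $|A(t)|$ is constant for all $t\in\mathbb{R}$, and a rigid rotation if $A(t)\in\mathrm{SO}(2,\mathbb{R})$ for all $t\in\mathbb{R}$. *)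

(* Defs.v *)
From mathcomp Require Export all_boot all_order all_algebra.
From mathcomp Require Export all_classical all_reals all_analysis.

Export Order.TTheory GRing.Theory Num.Theory.
Export numFieldNormedType.Exports.

Set Implicit Arguments.
Unset Strict Implicit.
Unset Printing Implicit Defensive.

Local Open Scope ring_scope.
Local Open Scope classical_set_scope.

(* The canonical norm `|A| on 'M[R]_2 is the sup norm.  It only provides the
   topology (continuity, derivatives); the Euclidean norm of the matrix space
   is [frobenius] below. *)
Definition inner (R : realType) (A B : 'M[R]_2) : R := \tr (A^T *m B).

Definition frobenius (R : realType) (A : 'M[R]_2) : R := Num.sqrt (inner A A).

Definition SL2 (R : realType) : set 'M[R]_2 := [set A | \det A = 1].

Definition SO2 (R : realType) : set 'M[R]_2 :=
  [set A | A^T *m A = 1%:M /\ \det A = 1].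

(* Z = [0, -1; 1, 0] *)
Definition Zmx (R : realType) : 'M[R]_2 := delta_mx 1 0 - delta_mx 0 1.

Definition Umx (R : realType) (theta : R) : 'M[R]_2 :=
  cos theta *: 1%:M + sin theta *: Zmx R.

Definition cof (R : realType) (A : 'M[R]_2) : 'M[R]_2 :=
  Zmx R *m A *m (Zmx R)^T.

Definition tangent_bundle (R : realType) : set ('M[R]_2 * 'M[R]_2) :=
  [set p | \det p.1 = 1 /\ inner p.2 (cof p.1) = 0].

Definition X1 (R : realType) (kappa : R) (A B : 'M[R]_2) : R :=
  2^-1 * frobenius B ^+ 2 + kappa / 2 * frobenius A ^+ 2.

Definition X2 (R : realType) (A B : 'M[R]_2) : R :=
  2^-1 * inner (Zmx R *m A - A *m Zmx R) B.

Definition X3 (R : realType) (A B : 'M[R]_2) : R :=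
  2^-1 * inner (Zmx R *m A + A *m Zmx R) B.

Definition C2 (R : realType) (V : normedModType R) (f : R -> V) : Prop :=
  [/\ forall t : R, derivable f t 1,
      forall t : R, derivable f^`() t 1
    & continuous f^`(2)].

Definition is_solution (R : realType) (kappa : R) (A : R -> 'M[R]_2) : Prop :=
  [/\ forall t : R, SL2 (A t),
      C2 A
    & exists2 lambda : R -> R, continuous lambda
      & forall t : R, A^`(2)%classic t + kappa *: A t = lambda t *: cof (A t)].

Definition equilibrium (R : realType) (A : R -> 'M[R]_2) : Prop :=
  exists C, forall t, A t = C.

Definition rigid (R : realType) (A : R -> 'M[R]_2) : Prop :=
  exists c, forall t, frobenius (A t) = c.

Definition rigid_rotation (R : realType) (A : R -> 'M[R]_2) : Prop :=
  forall t, SO2 (A t).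

(* Main.v *)
Require Import Defs.
From mathcomp Require Import ring lra.

Set Implicit Arguments.
Unset Strict Implicit.
Unset Printing Implicit Defensive.

Local Open Scope ring_scope.
Local Open Scope classical_set_scope.

(** The motion is governed by the single scalar h = |A|^2 / 2, which is at
least 1 on SL(2,R).  Along a solution det A = 1 and <A', cof A> = 0, so that
h' = <A, A'>, and with e = |A'|^2 / 2 and d = det A' two purely algebraic
identities hold ([kinetic_plus], [kinetic_minus]):
<<
   (h + 1) (e + d) = h'^2 / 4 + X3^2,
   (h - 1) (e - d) = h'^2 / 4 + X2^2.
>>
They express the splitting of a 2 x 2 matrix into its conformal and
anticonformal parts, of squared lengths (h + 1) / 2 and (h - 1) / 2 when both
are viewed as vectors of the plane, X3 and X2 being twice their angular momenta
up to sign.  Since X1, X2 and X3 are conserved, a linear combination of the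
two identities is the radial equation ([radial_equation])
<<
   h h'^2 / 4 = P(h),
   P(y) = (y^2 - 1) (X1 - kappa y) - X3^2 (y - 1) / 2 - X2^2 (y + 1) / 2.
>>

Sufficient conditions.  Each of the two sets of conditions on the initial
data, for rotations and for rigid motions off SO(2), implies that h(0) is a
double root of the cubic P, so that
P(h) = (h - h(0))^2 (X1 - 2 kappa h(0) - kappa h).  As h >= 1, this
gives h'^2 <= 4 X1 (h - h(0))^2, and Gronwall's inequality for
(h - h(0))^2 makes h constant ([radial_constant]).  The value h = 1
characterizes SO(2).

Necessary conditions.  If h is constant, then h' = 0 and h'' = 0; together
with the second derivative of det A = 1 this gives
e + d = (kappa - lambda) (h + 1) and e - d = (kappa + lambda) (h - 1)
([rigid_conditions]), and the claims follow by eliminating lambda with the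
help of the two kinetic identities.

Equilibria have A' = 0, hence are rigid with e = d = 0, which leaves
kappa = lambda and kappa (h - 1) = 0; conversely X1 = kappa forces e = 0 at
all times because h >= 1.  A rigid rotation satisfies A' = (X3 / 2) Z A
([rotation_velocity]), and the flow of this linear equation is
U (X3 t / 2) ([Zmx_flow]). *)

(** * Algebra of 2 x 2 matrices *)

Lemma sum_ord2 (V : nmodType) (F : 'I_2 -> V) : \sum_(i < 2) F i = F 0 + F 1.
Proof.
rewrite !big_ord_recl big_ord0 addr0; congr (_ + F _).
exact/val_inj.
Qed.

Lemma det_mx22E (R : comNzRingType) (A : 'M[R]_2) :
  \det A = A 0 0 * A 1 1 - A 0 1 * A 1 0.
Proof.
rewrite (expand_det_row A 0) sum_ord2 /cofactor !det_mx11 !mxE /=.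
have e0 : lift (0 : 'I_2) 0 = 1 by exact/val_inj.
have e1 : lift (1 : 'I_2) 0 = 0 by exact/val_inj.
rewrite e0 e1.
by rewrite expr0 expr1 mul1r mulN1r mulrN.
Qed.

Lemma matrix22P (T : Type) (A B : 'M[T]_2) :
  A 0 0 = B 0 0 -> A 0 1 = B 0 1 -> A 1 0 = B 1 0 -> A 1 1 = B 1 1 -> A = B.
Proof.
move=> e00 e01 e10 e11; apply/matrixP => i j.
have ord2 (k : 'I_2) : k = 0 \/ k = 1.
  by case: k => [[|[|//]] ?]; [left|right]; exact/val_inj.
by case: (ord2 i) => ->; case: (ord2 j) => ->.
Qed.

Lemma ZmxE (R : realType) :
  (Zmx R 0 0 = 0) * (Zmx R 0 1 = -1) * (Zmx R 1 0 = 1) * (Zmx R 1 1 = 0).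
Proof. by do !split; rewrite !mxE /= ?subrr ?subr0 ?sub0r. Qed.

Lemma mulmx22E (R : comNzRingType) (A B : 'M[R]_2) i j :
  (A *m B) i j = A i 0 * B 0 j + A i 1 * B 1 j.
Proof. by rewrite mxE sum_ord2. Qed.

Lemma trmxE (T : Type) m n (A : 'M[T]_(m, n)) i j : A^T i j = A j i.
Proof. by rewrite mxE. Qed.

Lemma innerE (R : realType) (A B : 'M[R]_2) :
  inner A B = A 0 0 * B 0 0 + A 0 1 * B 0 1 + A 1 0 * B 1 0 + A 1 1 * B 1 1.
Proof. by rewrite /inner /mxtrace !sum_ord2 !mulmx22E !trmxE; ring. Qed.

Lemma cofE (R : realType) (A : 'M[R]_2) :
  (cof A 0 0 = A 1 1) * (cof A 0 1 = - A 1 0) *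
  (cof A 1 0 = - A 0 1) * (cof A 1 1 = A 0 0).
Proof. by rewrite /cof !mulmx22E !trmxE !(ZmxE R); do !split; ring. Qed.

Lemma inner_ge0 (R : realType) (A : 'M[R]_2) : 0 <= inner A A.
Proof. by rewrite innerE -!expr2 !addr_ge0 ?sqr_ge0. Qed.

Lemma inner_eq0 (R : realType) (A : 'M[R]_2) : inner A A = 0 -> A = 0.
Proof.
rewrite innerE => e.
by apply: matrix22P; rewrite mxE; nra.
Qed.

Lemma frobenius_sqr (R : realType) (A : 'M[R]_2) : frobenius A ^+ 2 = inner A A.
Proof. exact/sqr_sqrtr/inner_ge0. Qed.

Lemma X2E (R : realType) (A B : 'M[R]_2) :
  X2 A B = 2^-1 * ((A 0 0 - A 1 1) * (B 0 1 + B 1 0)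
                   - (A 0 1 + A 1 0) * (B 0 0 - B 1 1)).
Proof.
by rewrite /X2 innerE !mxE !sum_ord2 !(ZmxE R); congr (_ * _); ring.
Qed.

Lemma X3E (R : realType) (A B : 'M[R]_2) :
  X3 A B = 2^-1 * ((A 0 0 + A 1 1) * (B 1 0 - B 0 1)
                   + (A 0 1 - A 1 0) * (B 0 0 + B 1 1)).
Proof.
by rewrite /X3 innerE !mxE !sum_ord2 !(ZmxE R); congr (_ * _); ring.
Qed.

Lemma innerC (R : realType) (A B : 'M[R]_2) : inner A B = inner B A.
Proof. by rewrite !innerE; ring. Qed.

Lemma inner_linr (R : realType) (x y : R) (A B C : 'M[R]_2) :
  inner A (x *: B - y *: C) = x * inner A B - y * inner A C.
Proof.
have e i j : (x *: B - y *: C) i j = x * B i j - y * C i j by rewrite !mxE.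
by rewrite !innerE !e; ring.
Qed.

Lemma inner_cof (R : realType) (A : 'M[R]_2) : inner A (cof A) = 2 * \det A.
Proof. by rewrite innerE !cofE det_mx22E; ring. Qed.

Lemma inner_cof_cof (R : realType) (A B : 'M[R]_2) :
  inner (cof A) (cof B) = inner A B.
Proof. by rewrite !innerE !cofE; ring. Qed.

Lemma inner_cofC (R : realType) (A B : 'M[R]_2) :
  inner A (cof B) = inner B (cof A).
Proof. by rewrite !innerE !cofE; ring. Qed.

Lemma X2xx (R : realType) (A : 'M[R]_2) : X2 A A = 0.
Proof. by rewrite X2E; ring. Qed.

Lemma X3xx (R : realType) (A : 'M[R]_2) : X3 A A = 0.
Proof. by rewrite X3E; ring. Qed.

Lemma X2_cof (R : realType) (A : 'M[R]_2) : X2 A (cof A) = 0.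
Proof. by rewrite X2E !cofE; ring. Qed.

Lemma X3_cof (R : realType) (A : 'M[R]_2) : X3 A (cof A) = 0.
Proof. by rewrite X3E !cofE; ring. Qed.

Lemma X1E (R : realType) (kappa : R) (A B : 'M[R]_2) :
  X1 kappa A B = 2^-1 * inner B B + kappa * (2^-1 * inner A A).
Proof. by rewrite /X1 !frobenius_sqr; ring. Qed.

Lemma inner_ge2 (R : realType) (A : 'M[R]_2) : \det A = 1 -> 2 <= inner A A.
Proof.
rewrite det_mx22E innerE => dA.
have := sqr_ge0 (A 0 0 - A 1 1); have := sqr_ge0 (A 0 1 + A 1 0); nra.
Qed.

Lemma SO2P (R : realType) (A : 'M[R]_2) :
  SO2 A <-> \det A = 1 /\ inner A A = 2.
Proof.
split=> [[AA dA]|[dA AA]]; split=> //; first by rewrite /inner AA mxtrace1.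
move: dA AA; rewrite det_mx22E innerE => dA AA.
have /eqP : (A 0 0 - A 1 1) ^+ 2 + (A 0 1 + A 1 0) ^+ 2 = 0 by nra.
rewrite paddr_eq0 ?sqr_ge0// !sqrf_eq0 subr_eq0 addr_eq0.
move=> /andP[/eqP e1 /eqP e2]; move: dA; rewrite e1 e2 => dA.
by apply: matrix22P; rewrite mulmx22E !trmxE [RHS]mxE/= ?e1 ?e2; lra.
Qed.

(** The two-dimensional Lagrange identity |w|^2 |w'|^2 = (w.w')^2 + (w x w')^2
for the conformal parts w and w' of A and B, multiplied by 4. *)
Lemma kinetic_plus (R : realType) (A B : 'M[R]_2) :
  tangent_bundle (A, B) ->
  (2^-1 * inner A A + 1) * (2^-1 * inner B B + \det B)
  = inner A B ^+ 2 / 4 + X3 A B ^+ 2.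
Proof.
move=> [/= dA tB].
(* The identity is homogeneous with h + det A and <A, B> + <B, cof A> in place
   of h + 1 and <A, B>. *)
have -> : inner A B = inner A B + inner B (cof A) by rewrite tB addr0.
by rewrite -[X in _ + X]dA !innerE !cofE X3E !det_mx22E; field.
Qed.

(** The same identity for the anticonformal parts. *)
Lemma kinetic_minus (R : realType) (A B : 'M[R]_2) :
  tangent_bundle (A, B) ->
  (2^-1 * inner A A - 1) * (2^-1 * inner B B - \det B)
  = inner A B ^+ 2 / 4 + X2 A B ^+ 2.
Proof.
move=> [/= dA tB].
have -> : inner A B = inner A B - inner B (cof A) by rewrite tB subr0.
by rewrite -[X in _ - X]dA !innerE !cofE X2E !det_mx22E; field.
Qed.

Lemma radial_equation (R : realType) (kappa : R) (A B : 'M[R]_2) :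
  tangent_bundle (A, B) ->
  let h := 2^-1 * inner A A in
  h * inner A B ^+ 2 / 4 = (h ^+ 2 - 1) * (X1 kappa A B - kappa * h)
    - X3 A B ^+ 2 * (h - 1) / 2 - X2 A B ^+ 2 * (h + 1) / 2.
Proof.
move=> tAB h; have := kinetic_plus tAB; have := kinetic_minus tAB.
rewrite X1E -/h => /(congr1 ( *%R (h + 1))) em /(congr1 ( *%R (h - 1))) ep.
nra.
Qed.

(** * Derivatives of matrix-valued functions *)

Lemma is_derive_mxP (R : realType) m n (F : R -> 'M[R]_(m, n))
    (F' : 'M[R]_(m, n)) (t : R) :
  is_derive t (1 : R) F F' <->
  forall i j, is_derive t (1 : R) (fun s => F s i j) (F' i j).
Proof.
split=> [[dF eF] i j|dF].
- apply: DeriveDef; first exact: (derivable_mxP F t 1).1.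
  by rewrite -eF derive_mx// mxE.
- have dF1 : derivable F t 1.
    by apply/derivable_mxP => i j; case: (dF i j).
  apply: DeriveDef => //; rewrite derive_mx//; apply/matrixP => i j.
  by rewrite mxE; case: (dF i j).
Qed.

Lemma is_derive_mulmx (R : realType) (F G : R -> 'M[R]_2) (F' G' : 'M[R]_2) (t : R) :
  is_derive t (1 : R) F F' -> is_derive t (1 : R) G G' ->
  is_derive t (1 : R) (fun s => F s *m G s) (F' *m G t + F t *m G').
Proof.
move=> /is_derive_mxP dF /is_derive_mxP dG; apply/is_derive_mxP => i j.
have -> : (fun s => (F s *m G s) i j) =
  (fun s => F s i 0) * (fun s => G s 0 j) +
  (fun s => F s i 1) * (fun s => G s 1 j).
  by apply/funext => s; rewrite mulmx22E.
apply: is_derive_eq.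
by rewrite [RHS]mxE !mulmx22E /GRing.scale/=; ring.
Qed.

Lemma is_derive_inner (R : realType) (F G : R -> 'M[R]_2) (F' G' : 'M[R]_2) (t : R) :
  is_derive t (1 : R) F F' -> is_derive t (1 : R) G G' ->
  is_derive t (1 : R) (fun s => inner (F s) (G s))
    (inner F' (G t) + inner (F t) G').
Proof.
move=> /is_derive_mxP dF /is_derive_mxP dG.
have -> : (fun s => inner (F s) (G s)) =
  (fun s => F s 0 0) * (fun s => G s 0 0) +
  (fun s => F s 0 1) * (fun s => G s 0 1) +
  (fun s => F s 1 0) * (fun s => G s 1 0) +
  (fun s => F s 1 1) * (fun s => G s 1 1).
  by apply/funext => s; rewrite innerE.
have dM i j := is_deriveM (dF i j) (dG i j).
apply: (is_derive_eq (is_deriveD (is_deriveD (is_deriveD (dM 0 0) (dM 0 1))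
  (dM 1 0)) (dM 1 1))).
by rewrite !innerE /GRing.scale/=; ring.
Qed.

Lemma is_derive_mulmxl (R : realType) (M : 'M[R]_2) (F : R -> 'M[R]_2)
    (F' : 'M[R]_2) (t : R) :
  is_derive t (1 : R) F F' -> is_derive t (1 : R) (fun s => M *m F s) (M *m F').
Proof.
move=> dF; have := @is_derive_mulmx R (cst M) F 0 F' t (is_derive_cst M t (1 : R)) dF.
by rewrite mul0mx add0r.
Qed.

Lemma is_derive_mulmxr (R : realType) (M : 'M[R]_2) (F : R -> 'M[R]_2)
    (F' : 'M[R]_2) (t : R) :
  is_derive t (1 : R) F F' -> is_derive t (1 : R) (fun s => F s *m M) (F' *m M).
Proof.
move=> dF; have := @is_derive_mulmx R F (cst M) F' 0 t dF (is_derive_cst M t (1 : R)).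
by rewrite mulmx0 addr0.
Qed.

Lemma is_derive_cof (R : realType) (F : R -> 'M[R]_2) (F' : 'M[R]_2) (t : R) :
  is_derive t (1 : R) F F' -> is_derive t (1 : R) (fun s => cof (F s)) (cof F').
Proof. by move=> dF; apply: is_derive_mulmxr; apply: is_derive_mulmxl. Qed.

Lemma is_derive_Umx (R : realType) (w t : R) :
  is_derive t (1 : R) (fun s => Umx (w * s)) (w *: (Zmx R *m Umx (w * t))).
Proof.
have dw : is_derive t (1 : R) (fun s => w * s) w.
  by apply: is_derive_eq; rewrite /GRing.scale/= mulr1.
have dc : is_derive t (1 : R) (fun s => cos (w * s)) (- sin (w * t) * w).
  exact: is_derive1_comp.
have ds : is_derive t (1 : R) (fun s => sin (w * s)) (cos (w * t) * w).
  exact: is_derive1_comp.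
apply/is_derive_mxP => i j.
have -> : (fun s => Umx (w * s) i j) =
  (1%:M : 'M[R]_2) i j *: (fun s => cos (w * s)) +
  Zmx R i j *: (fun s => sin (w * s)).
  apply/funext => s; rewrite /Umx !mxE.
  by rewrite [X in X + _ = _]mulrC [X in _ + X = _]mulrC.
apply: (is_derive_eq (is_deriveD (is_deriveZ _ dc) (is_deriveZ _ ds))).
have ZZ : Zmx R *m Zmx R = - 1%:M.
  by apply: matrix22P; rewrite mulmx22E !(ZmxE R) !mxE/=; ring.
rewrite /Umx mulmxDr -!scalemxAr mulmx1 ZZ /GRing.scale/= !mxE/=; ring.
Qed.

(** * A Gronwall inequality *)

Lemma is_derive_le0_nincr (R : realType) (f f' : R -> R) (x y : R) :
  (forall t, is_derive t (1 : R) f (f' t)) -> (forall t, f' t <= 0) -> x <= y ->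
  f y <= f x.
Proof.
move=> df f'0 xy.
have dvf t : derivable f t 1 by case: (df t).
apply: (@ler0_derive1_nincr R f x y) => //.
- by move=> t _; rewrite derive1E; case: (df t) => _ ->.
- apply: continuous_subspaceT => t; apply: differentiable_continuous.
  exact/derivable1_diffP.
Qed.

(** Two-sided in time: f(t) exp(-C t) is nonincreasing and f(t) exp(C t) is
nondecreasing, which bounds f above by 0 on both sides of the origin. *)
Lemma gronwall_eq0 (R : realType) (f f' : R -> R) (C : R) :
  (forall t, is_derive t (1 : R) f (f' t)) -> (forall t, 0 <= f t) ->
  (forall t, `|f' t| <= C * f t) -> f 0 = 0 -> forall t, f t = 0.
Proof.
move=> df f0 f'C f00 t; apply/eqP; rewrite eq_le f0 andbT.
have dexp c s : is_derive s (1 : R) (fun u => expR (c * u)) (expR (c * s) * c).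
  have dc : is_derive s (1 : R) (fun u => c * u) c.
    by apply: is_derive_eq; rewrite /GRing.scale/= mulr1.
  exact: is_derive1_comp.
have dg c s : is_derive s (1 : R) (fun u => f u * expR (c * u))
    ((f' s + c * f s) * expR (c * s)).
  have dfs := df s; have dcs := dexp c s.
  have -> : (fun u => f u * expR (c * u)) = f * (fun u => expR (c * u)) by [].
  by apply: is_derive_eq; rewrite /GRing.scale/=; ring.
have [t0|/ltW t0] := leP 0 t.
- rewrite -(pmulr_lle0 _ (expR_gt0 (- C * t))).
  have := is_derive_le0_nincr (dg (- C)) _ t0; rewrite f00 mul0r; apply => s.
  by have := f'C s; rewrite pmulr_lle0 ?expR_gt0// ler_norml; lra.
- rewrite -(pmulr_lle0 _ (expR_gt0 (C * t))).
  have dgN s := is_deriveN (dg C s).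
  rewrite -oppr_ge0.
  have {1}-> : 0 = - (f 0 * expR (C * 0)) by rewrite f00 mul0r oppr0.
  apply: (is_derive_le0_nincr dgN _ t0) => s.
  rewrite oppr_le0 mulr_ge0 ?expR_ge0//.
  by have := f'C s; rewrite ler_norml; lra.
Qed.

(** * Conservation laws along solutions *)

Lemma solution_is_derive (R : realType) (kappa : R) (A : R -> 'M[R]_2) t :
  is_solution kappa A ->
  is_derive t (1 : R) A (A^`()%classic t) /\
  is_derive t (1 : R) A^`()%classic (A^`(2)%classic t).
Proof.
move=> [_ [dA ddA _] _]; split.
  by apply: DeriveDef; [exact: dA | rewrite derive1E].
by apply: DeriveDef; [exact: ddA | rewrite derive1nS derive1n1 derive1E].
Qed.

Lemma is_derive_cst_eq0 (R : realType) (V : normedModType R) (f : R -> V) c (t : R) d :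
  (forall s, f s = c) -> is_derive t (1 : R) f d -> d = 0.
Proof.
move=> fc [_ <-]; have -> : f = cst c by exact/funext.
by rewrite derive_cst.
Qed.

Lemma solution_tangent (R : realType) (kappa : R) (A : R -> 'M[R]_2) t :
  is_solution kappa A -> tangent_bundle (A t, A^`()%classic t).
Proof.
move=> solA; have [dA _] := solution_is_derive t solA.
have [SL _ _] := solA; split=> /=; first exact: SL.
have inner2 s : inner (A s) (cof (A s)) = 2 by rewrite inner_cof SL mulr1.
have := is_derive_cst_eq0 inner2 (is_derive_inner dA (is_derive_cof dA)).
by rewrite [inner (A t) _]inner_cofC; lra.
Qed.

(** The scalar relation is the second derivative of det A = 1; it determines
the multiplier [l]. *)
Lemma solution_acceleration (R : realType) (kappa : R) (A : R -> 'M[R]_2) t :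
  is_solution kappa A ->
  exists l, A^`(2)%classic t = l *: cof (A t) - kappa *: A t /\
    \det (A^`()%classic t) - kappa + l * (2^-1 * inner (A t) (A t)) = 0.
Proof.
move=> solA; have [dA ddA] := solution_is_derive t solA.
have [SL _ [lam _ eqA]] := solA; exists (lam t).
have eA : A^`(2)%classic t = lam t *: cof (A t) - kappa *: A t.
  by rewrite -eqA addrK.
split=> //; have := is_derive_inner ddA (is_derive_cof dA).
have tA s : inner (A^`()%classic s) (cof (A s)) = 0.
  by have [] := solution_tangent s solA.
move/(is_derive_cst_eq0 tA).
rewrite inner_cof eA innerC inner_linr inner_cof_cof [inner (cof _) _]innerC.
by rewrite inner_cof SL; lra.
Qed.

Lemma X1_conserved (R : realType) (kappa : R) (A : R -> 'M[R]_2) t :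
  is_solution kappa A -> X1 kappa (A t) (A^`()%classic t) = X1 kappa (A 0) (A^`()%classic 0).
Proof.
move=> solA.
rewrite -[LHS]/((fun s => X1 kappa (A s) (A^`()%classic s)) t).
apply: (@is_derive_0_is_cst R (fun s => X1 kappa (A s) (A^`()%classic s)) t 0) => s.
have [dA ddA] := solution_is_derive s solA.
have [_ tA] := solution_tangent s solA.
have [l [eA _]] := solution_acceleration s solA.
have -> : (fun s => X1 kappa (A s) (A^`()%classic s)) =
    2^-1 *: (fun s => inner (A^`()%classic s) (A^`()%classic s)) +
    (kappa / 2) *: (fun s => inner (A s) (A s)).
  by apply/funext => u; rewrite X1E mulrA.
apply: (is_derive_eq (is_deriveD (is_deriveZ _ (is_derive_inner ddA ddA))
  (is_deriveZ _ (is_derive_inner dA dA)))).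
rewrite ![inner (A^`(2)%classic s) _]innerC ![inner (A s) _]innerC eA inner_linr.
rewrite /= in tA.
by rewrite tA /GRing.scale/=; field.
Qed.

Lemma is_derive_X2 (R : realType) (F G : R -> 'M[R]_2) (F' G' : 'M[R]_2) (t : R) :
  is_derive t (1 : R) F F' -> is_derive t (1 : R) G G' ->
  is_derive t (1 : R) (fun s => X2 (F s) (G s)) (X2 F' (G t) + X2 (F t) G').
Proof.
move=> dF dG; have dL := is_deriveB (is_derive_mulmxl (Zmx R) dF)
  (is_derive_mulmxr (Zmx R) dF).
apply: (is_derive_eq (is_deriveZ 2^-1 (is_derive_inner dL dG))).
exact: scalerDr.
Qed.

Lemma is_derive_X3 (R : realType) (F G : R -> 'M[R]_2) (F' G' : 'M[R]_2) (t : R) :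
  is_derive t (1 : R) F F' -> is_derive t (1 : R) G G' ->
  is_derive t (1 : R) (fun s => X3 (F s) (G s)) (X3 F' (G t) + X3 (F t) G').
Proof.
move=> dF dG; have dL := is_deriveD (is_derive_mulmxl (Zmx R) dF)
  (is_derive_mulmxr (Zmx R) dF).
apply: (is_derive_eq (is_deriveZ 2^-1 (is_derive_inner dL dG))).
exact: scalerDr.
Qed.

Lemma X2_conserved (R : realType) (kappa : R) (A : R -> 'M[R]_2) t :
  is_solution kappa A -> X2 (A t) (A^`()%classic t) = X2 (A 0) (A^`()%classic 0).
Proof.
move=> solA.
apply: (@is_derive_0_is_cst R (fun s => X2 (A s) (A^`()%classic s)) t 0) => s.
have [dA ddA] := solution_is_derive s solA.
have [l [eA _]] := solution_acceleration s solA.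
apply: (is_derive_eq (is_derive_X2 dA ddA)).
by rewrite eA X2xx {1}/X2 inner_linr mulrBr mulrCA -/(X2 _ _) X2_cof
  mulrCA -/(X2 _ _) X2xx; ring.
Qed.

Lemma X3_conserved (R : realType) (kappa : R) (A : R -> 'M[R]_2) t :
  is_solution kappa A -> X3 (A t) (A^`()%classic t) = X3 (A 0) (A^`()%classic 0).
Proof.
move=> solA.
apply: (@is_derive_0_is_cst R (fun s => X3 (A s) (A^`()%classic s)) t 0) => s.
have [dA ddA] := solution_is_derive s solA.
have [l [eA _]] := solution_acceleration s solA.
apply: (is_derive_eq (is_derive_X3 dA ddA)).
by rewrite eA X3xx {1}/X3 inner_linr mulrBr mulrCA -/(X3 _ _) X3_cof
  mulrCA -/(X3 _ _) X3xx; ring.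
Qed.

Lemma is_derive_halfsq (R : realType) (F : R -> 'M[R]_2) (F' : 'M[R]_2) (t : R) :
  is_derive t (1 : R) F F' ->
  is_derive t (1 : R) (fun s => 2^-1 * inner (F s) (F s)) (inner (F t) F').
Proof.
move=> dF; apply: (is_derive_eq (is_deriveZ 2^-1 (is_derive_inner dF dF))).
by rewrite [inner F' _]innerC /GRing.scale/=; field.
Qed.

(** * Motions of constant norm *)

(** The two hypotheses say that h is a double root of the cubic of the radial
equation. *)
Lemma radial_constant (R : realType) (kappa : R) (A : R -> 'M[R]_2) :
  0 <= kappa -> is_solution kappa A ->
  let x1 := X1 kappa (A 0) (A^`()%classic 0) in
  let x2 := X2 (A 0) (A^`()%classic 0) in
  let x3 := X3 (A 0) (A^`()%classic 0) in
  let h := 2^-1 * inner (A 0) (A 0) in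
  (h ^+ 2 - 1) * (x1 - kappa * h)
    = x3 ^+ 2 * (h - 1) / 2 + x2 ^+ 2 * (h + 1) / 2 ->
  2 * h * (x1 - kappa * h) - kappa * (h ^+ 2 - 1) = (x3 ^+ 2 + x2 ^+ 2) / 2 ->
  forall t, 2^-1 * inner (A t) (A t) = h.
Proof.
move=> k0 solA x1 x2 x3 h root root' t.
pose y s := 2^-1 * inner (A s) (A s); pose r s := inner (A s) (A^`()%classic s).
have dy s : is_derive s (1 : R) y (r s).
  by have [dA _] := solution_is_derive s solA; exact: is_derive_halfsq.
have df s : is_derive s (1 : R) (fun u => (y u - h) ^+ 2) (2 * (y s - h) * r s).
  have dyh := is_deriveB (dy s) (is_derive_cst h s (1 : R)).
  apply: (is_derive_eq (is_deriveX 2 dyh)).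
  by rewrite subr0 /= expr1.
have y1 s : 1 <= y s.
  by have [dA _ _] := solA; have := inner_ge2 (dA s); rewrite /y; lra.
have h1 : 1 <= h by exact: y1.
have x10 : 0 <= x1.
  rewrite /x1 X1E addr_ge0 ?mulr_ge0 ?inner_ge0//; lra.
have r2 s : r s ^+ 2 <= 4 * x1 * (y s - h) ^+ 2.
  have := radial_equation kappa (solution_tangent s solA); cbv zeta.
  rewrite X1_conserved// (X2_conserved s solA) (X3_conserved s solA).
  rewrite -/x1 -/x2 -/x3 -/(y s) -/(r s) => e.
  have {}e : y s * r s ^+ 2 = 4 * ((y s - h) ^+ 2 * (x1 - kappa * (2 * h + y s))).
    (* Taylor expansion of the cubic at its double root h. *)
    move/(congr1 ( *%R (y s - h))): root' => root'.
    by lra.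
  have a1 : r s ^+ 2 <= y s * r s ^+ 2 by rewrite ler_peMl ?sqr_ge0.
  apply: (le_trans a1); rewrite e -mulrA ler_pM2l// [leRHS]mulrC.
  rewrite ler_wpM2l ?sqr_ge0// gerBl mulr_ge0//.
  by have := y1 s; lra.
have f0 : forall s, (y s - h) ^+ 2 = 0.
  apply: (gronwall_eq0 (C := 1 + 4 * x1) df).
  - by move=> s; exact: sqr_ge0.
  - (* 2 |(y - h) r| <= (y - h)^2 + r^2 *)
    move=> s; have := r2 s.
    have := sqr_ge0 (y s - h + r s); have := sqr_ge0 (y s - h - r s).
    by rewrite ler_norml => *; apply/andP; split; nra.
  - by rewrite subrr expr0n.
by have /eqP := f0 t; rewrite sqrf_eq0 subr_eq0 => /eqP.
Qed.

(** For rigid motions, the vanishing of the first two derivatives of h = c,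
combined with the second derivative of det A = 1. *)
Lemma rigid_conditions (R : realType) (kappa c : R) (A : R -> 'M[R]_2) :
  is_solution kappa A -> (forall t, 2^-1 * inner (A t) (A t) = c) ->
  forall t, let e := 2^-1 * inner (A^`()%classic t) (A^`()%classic t) in
  let d := \det (A^`()%classic t) in
  inner (A t) (A^`()%classic t) = 0 /\
  exists l, e + d = (kappa - l) * (c + 1) /\ e - d = (kappa + l) * (c - 1).
Proof.
move=> solA hc t e d.
have r0 s : inner (A s) (A^`()%classic s) = 0.
  have [dA _] := solution_is_derive s solA.
  exact: (is_derive_cst_eq0 hc (is_derive_halfsq dA)).
split=> //; have [dA ddA] := solution_is_derive t solA.
have [l [eA de]] := solution_acceleration t solA; exists l.
have := is_derive_cst_eq0 r0 (is_derive_inner dA ddA).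
have [/(_ t) SL _ _] := solA.
rewrite eA inner_linr inner_cof SL; move: de (hc t); rewrite -/d /e => + <-.
by split; lra.
Qed.

(** * Equilibria, rotations and rigid motions *)

(** The solutions of F' = w Z F.  As Z is skew, the norm of the difference of
two solutions is constant, which gives uniqueness. *)
Lemma Zmx_flow (R : realType) (w : R) (F : R -> 'M[R]_2) :
  (forall t, is_derive t (1 : R) F (w *: (Zmx R *m F t))) ->
  forall t, F t = Umx (w * t) *m F 0.
Proof.
move=> dF t; pose D s := F s - Umx (w * s) *m F 0.
have dD s : is_derive s (1 : R) D (w *: (Zmx R *m D s)).
  apply: (is_derive_eq (is_deriveB (dF s)
    (is_derive_mulmxr (F 0) (is_derive_Umx w s)))).
  by rewrite /D mulmxBr scalerBr -scalemxAl mulmxA.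
have skew (M : 'M[R]_2) : inner M (w *: (Zmx R *m M)) = 0.
  have e i j : (w *: (Zmx R *m M)) i j = w * (Zmx R *m M) i j by rewrite mxE.
  by rewrite innerE !e !mulmx22E !(ZmxE R); ring.
have /(_ t 0) : forall x y, 2^-1 * inner (D x) (D x) = 2^-1 * inner (D y) (D y).
  move=> x y; apply: (@is_derive_0_is_cst R (fun s => 2^-1 * inner (D s) (D s))).
  by move=> s; apply: (is_derive_eq (is_derive_halfsq (dD s))); exact: skew.
have -> : D 0 = 0.
  by rewrite /D mulr0 /Umx cos0 sin0 scale1r scale0r addr0 mul1mx subrr.
rewrite [inner 0 0]/inner mulmx0 mxtrace0 mulr0 => e.
by apply/eqP; rewrite -subr_eq0; apply/eqP/inner_eq0; move: e; rewrite /D; lra.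
Qed.

Lemma rigidP (R : realType) (A : R -> 'M[R]_2) :
  rigid A <-> forall t, 2^-1 * inner (A t) (A t) = 2^-1 * inner (A 0) (A 0).
Proof.
split=> [[c hc] t|hc]; first by rewrite -!frobenius_sqr !hc.
exists (frobenius (A 0)) => t; congr Num.sqrt.
by have := hc t; lra.
Qed.

Lemma equilibrium_iff (R : realType) (kappa : R) (A : R -> 'M[R]_2) :
  0 <= kappa -> is_solution kappa A ->
  equilibrium A <-> X1 kappa (A 0) (A^`()%classic 0) = kappa.
Proof.
move=> k0 solA; have [SL _ _] := solA; split=> [[C AC]|x1k].
- have [dA _] := solution_is_derive 0 solA.
  have B0 := is_derive_cst_eq0 AC dA.
  have hc t : 2^-1 * inner (A t) (A t) = 2^-1 * inner (A 0) (A 0).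
    by rewrite !AC.
  have [_ [l]] := rigid_conditions solA hc 0.
  have i0 : inner (0 : 'M[R]_2) 0 = 0 by rewrite /inner mulmx0 mxtrace0.
  have d0 : \det (0 : 'M[R]_2) = 0 by rewrite det0.
  rewrite X1E B0 i0 d0; have := inner_ge2 (SL 0).
  move: (inner _ _) => q q2 [ep em].
  have kl : kappa = l by nra.
  by move: em; rewrite -kl; nra.
- have A'0 t : A^`()%classic t = 0.
    apply: inner_eq0; have := X1_conserved t solA; rewrite x1k X1E.
    have := inner_ge2 (SL t); have := inner_ge0 (A^`()%classic t).
    by move: (inner (A t) _) (inner _ _) => p q; nra.
  (* zero velocity is the flow of w Z with w = 0 *)
  have dA s : is_derive s (1 : R) A (0 *: (Zmx R *m A s)).
    by have [] := solution_is_derive s solA; rewrite A'0 scale0r.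
  by exists (Umx 0 *m A 0) => t; rewrite (Zmx_flow dA t) mul0r.
Qed.

(** The kinetic identities give X2 = 0 and <A, B> = 0, so that
|B - (X3 / 2) Z A|^2 = 0. *)
Lemma rotation_velocity (R : realType) (A B : 'M[R]_2) :
  tangent_bundle (A, B) -> inner A A = 2 -> inner B B = 2 * \det B ->
  B = (2^-1 * X3 A B) *: (Zmx R *m A).
Proof.
move=> tAB AA BB; have := kinetic_minus tAB; have := kinetic_plus tAB.
rewrite AA BB => kp km.
have x2 : X2 A B = 0.
  apply/eqP; rewrite -sqrf_eq0; apply/eqP.
  by have := sqr_ge0 (X2 A B); have := sqr_ge0 (inner A B); lra.
have r0 : inner A B ^+ 2 = 0 by move: km; rewrite x2; lra.
apply/eqP; rewrite -subr_eq0; apply/eqP/inner_eq0.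
have -> w : inner (B - w *: (Zmx R *m A)) (B - w *: (Zmx R *m A)) =
    inner B B - 2 * w * (X2 A B + X3 A B) + w ^+ 2 * inner A A.
  have e i j : (B - w *: (Zmx R *m A)) i j = B i j - w * (Zmx R *m A) i j.
    by rewrite !mxE.
  by rewrite X2E X3E !innerE !e !mulmx22E !(ZmxE R); field.
by rewrite x2 AA BB; move: kp; rewrite r0; lra.
Qed.

(** The relation e = d between e = |A'|^2 / 2 and d = det A'. *)
Lemma rotation_kinetic (R : realType) (kappa : R) (A : R -> 'M[R]_2) t :
  is_solution kappa A -> rigid_rotation A ->
  inner (A^`()%classic t) (A^`()%classic t) = 2 * \det (A^`()%classic t).
Proof.
move=> solA rotA.
have hc s : 2^-1 * inner (A s) (A s) = 1.
  by have [_ ->] := (SO2P (A s)).1 (rotA s); lra.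
by have [_ [l [_]]] := rigid_conditions solA hc t; lra.
Qed.

Lemma rotation_formula (R : realType) (kappa : R) (A : R -> 'M[R]_2) t :
  is_solution kappa A -> rigid_rotation A ->
  A t = Umx (2^-1 * X3 (A 0) (A^`()%classic 0) * t) *m A 0.
Proof.
move=> solA rotA; apply: Zmx_flow => s.
have [dA _] := solution_is_derive s solA; apply: (is_derive_eq dA).
rewrite -(X3_conserved s solA); apply: rotation_velocity.
- exact: solution_tangent solA.
- by have [] := (SO2P (A s)).1 (rotA s).
- exact: rotation_kinetic solA rotA.
Qed.

Lemma rotation_iff (R : realType) (kappa : R) (A : R -> 'M[R]_2) :
  0 <= kappa -> is_solution kappa A ->
  rigid_rotation A <-> SO2 (A 0) /\
    X1 kappa (A 0) (A^`()%classic 0)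
    = kappa + 4^-1 * X3 (A 0) (A^`()%classic 0) ^+ 2.
Proof.
move=> k0 solA; have [SL _ _] := solA.
have tA := solution_tangent 0 solA; split=> [rotA|[rot0 x1E]].
- have rot0 := rotA 0; split=> //; have [_ AA] := (SO2P (A 0)).1 rot0.
  have BB := rotation_kinetic 0 solA rotA.
  have := kinetic_plus tA; have := kinetic_minus tA.
  rewrite X1E AA BB.
  have := sqr_ge0 (X2 (A 0) (A^`()%classic 0)).
  by have := sqr_ge0 (inner (A 0) (A^`()%classic 0)); lra.
- have [_ AA] := (SO2P (A 0)).1 rot0.
  have x20 : X2 (A 0) (A^`()%classic 0) ^+ 2 = 0.
    have := kinetic_minus tA; have := sqr_ge0 (X2 (A 0) (A^`()%classic 0)).
    by have := sqr_ge0 (inner (A 0) (A^`()%classic 0)); rewrite AA; lra.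
  have hc : forall t, 2^-1 * inner (A t) (A t) = 2^-1 * inner (A 0) (A 0).
    by apply: (radial_constant k0 solA); rewrite AA x20 ?x1E; lra.
  by move=> t; apply/SO2P; split; [exact: SL | have := hc t; rewrite AA; lra].
Qed.

Lemma rigid_iff (R : realType) (kappa : R) (A : R -> 'M[R]_2) :
  0 <= kappa -> is_solution kappa A ->
  let x1 := X1 kappa (A 0) (A^`()%classic 0) in
  let x2 := X2 (A 0) (A^`()%classic 0) in
  let x3 := X3 (A 0) (A^`()%classic 0) in
  let h := 2^-1 * inner (A 0) (A 0) in
  1 < h ->
  rigid A <->
    x1 = 2^-1 * (x2 ^+ 2 / (h - 1) + x3 ^+ 2 / (h + 1)) + kappa * h /\
    x2 ^+ 2 / (h - 1) ^+ 2 + x3 ^+ 2 / (h + 1) ^+ 2 = 2 * kappa.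
Proof.
move=> k0 solA x1 x2 x3 h h1.
have hm : h - 1 != 0 by rewrite subr_eq0 gt_eqF.
have hp : h + 1 != 0 by rewrite gt_eqF//; lra.
split=> [/rigidP hc|[e1 e2]].
- have [r0 [l]] := rigid_conditions solA hc 0; rewrite -/h => -[ep em].
  have := kinetic_plus (solution_tangent 0 solA).
  have := kinetic_minus (solution_tangent 0 solA).
  rewrite r0 -/h -/x2 -/x3 expr0n mul0r !add0r ep em => <- <-.
  have -> : x1 = 2^-1 * ((kappa + l) * (h - 1) + (kappa - l) * (h + 1))
                 + kappa * h by rewrite /x1 X1E -/h -ep -em; field.
  by split; field; rewrite hm hp.
- apply/rigidP; move: e1 e2.
  (* In the variables p and q the conditions are polynomial. *)
  set p := x2 ^+ 2 / (h - 1) ^+ 2; set q := x3 ^+ 2 / (h + 1) ^+ 2.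
  have ex2 : x2 ^+ 2 = p * (h - 1) ^+ 2 by rewrite /p; field.
  have ex3 : x3 ^+ 2 = q * (h + 1) ^+ 2 by rewrite /q; field.
  have -> : x2 ^+ 2 / (h - 1) = p * (h - 1) by rewrite ex2; field.
  have -> : x3 ^+ 2 / (h + 1) = q * (h + 1) by rewrite ex3; field.
  move=> e1 e2; have ek : kappa = (p + q) / 2 by lra.
  apply: (radial_constant k0 solA); rewrite -/x1 -/x2 -/x3 -/h ex2 ex3 e1 addrK.
  + by field.
  + by rewrite ek; field.
Qed.

Theorem theorem10p2 (R : realType) (kappa : R) (A : R -> 'M[R]_2)
    (A0 B0 : 'M[R]_2)
    (hkappa : 0 <= kappa)
    (hsol : is_solution kappa A)
    (hA0 : A 0 = A0) (hB0 : A^`() 0 = B0)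
    (hD : tangent_bundle (A0, B0)) :
  let x1 := X1 kappa A0 B0 in
  let x2 := X2 A0 B0 in
  let x3 := X3 A0 B0 in
  let h := 2^-1 * frobenius A0 ^+ 2 in
  [/\ equilibrium A <-> x1 = kappa,
      (rigid_rotation A <-> SO2 A0 /\ x1 = kappa + 4^-1 * x3 ^+ 2) /\
      (rigid_rotation A -> forall t, A t = Umx (2^-1 * x3 * t) *m A0)
    & (rigid A /\ 2 < frobenius A0 ^+ 2) <->
      [/\ 2 < frobenius A0 ^+ 2,
          x1 = 2^-1 * (x2 ^+ 2 / (h - 1) + x3 ^+ 2 / (h + 1))
               + kappa / 2 * frobenius A0 ^+ 2
        & x2 ^+ 2 / (h - 1) ^+ 2 + x3 ^+ 2 / (h + 1) ^+ 2 = 2 * kappa]].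
Proof.
subst A0 B0 => x1 x2 x3 h; split.
- exact: equilibrium_iff.
- split; first exact: rotation_iff.
  by move=> rotA t; exact: rotation_formula hsol rotA.
- have rig := rigid_iff hkappa hsol.
  rewrite /= -/x1 -/x2 -/x3 -frobenius_sqr -/h in rig.
  have -> : kappa / 2 * frobenius (A 0) ^+ 2 = kappa * h by rewrite -mulrA.
  have h1 : 2 < frobenius (A 0) ^+ 2 -> 1 < h by rewrite /h; lra.
  split=> [[rA f2]|[f2 e1 e2]].
  + by have [e1 e2] := (rig (h1 f2)).1 rA.
  + by split=> //; apply/(rig (h1 f2)).2.
Qed.
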